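(* A finitely generated Abelian group $G$ is morphic if and only if it is weakly-morphic as a $\mathbb{Z}$-module and, for each prime $p$, its $(p)$-primary component has the form $(\mathbb{Z}_{p^k})^n$ for some non-negative integers $n$ and $k$ (depending on $p$).
   Context: An Abelian group $G$ is morphic if $G/\alpha(G)\cong\ker(\alpha)$ for every endomorphism $\alpha$ of $G$ (equivalently, $G$ is morphic as a $\mathbb{Z}$-module). $G$ is weakly-morphic as a $\mathbb{Z}$-module if $G/Ga\cong\{g\in G: ga=0\}$ as $\mathbb{Z}$-modules for every $a\in\mathbb{Z}$, where $Ga=\{ga: g\in G\}$. $\mathbb{Z}_{m}$ denotes the integers modulo $m$. The $(p)$-primary component of $G$ is the subgroup of elements whose order is a power of $p$. *)

(* Defs.v *)
From HB Require Import structures.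
From mathcomp Require Import all_boot all_order all_algebra.
From mathcomp Require Import boolp.

Set Implicit Arguments.
Unset Strict Implicit.
Unset Printing Implicit Defensive.

Import GRing.Theory.
Local Open Scope ring_scope.

(* Subgroups of an abelian group are the library's [zmodClosed] predicates.
   They are not assumed decidable: membership is made boolean by [asbool].
   [{ideal_quot S}] is the library's quotient of a [zmodType] by such an [S]
   (the name notwithstanding, no ring structure is involved). *)

Definition subgroup_type (G : zmodType) (S : zmodClosed G) : Type :=
  {x : G | x \in S}.

HB.instance Definition _ (G : zmodType) (S : zmodClosed G) :=
  SubChoice.on (subgroup_type S).
HB.instance Definition _ (G : zmodType) (S : zmodClosed G) :=
  [SubChoice_isSubZmodule of subgroup_type S by <:].

Definition isomorphic (U V : zmodType) : Prop :=
  exists f : {additive U -> V}, bijective f.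

Definition finitely_generated (G : zmodType) : Prop :=
  exists s : seq G, forall g : G,
    exists c : 'I_(size s) -> int, g = \sum_(i < size s) s`_i *~ c i.

Section EndoSubgroups.
Variables (G : zmodType) (alpha : {additive G -> G}).

Definition image_of : {pred G} := fun y => `[< exists x, alpha x = y >].

Definition kernel_of : {pred G} := fun x => `[< alpha x = 0 >].

Lemma image_of_closed : zmod_closed image_of.
Proof.
split; first by apply/asboolP; exists 0; rewrite raddf0.
move=> _ _ /asboolP[x <-] /asboolP[y <-].
by apply/asboolP; exists (x - y); rewrite raddfB.
Qed.

Lemma kernel_of_closed : zmod_closed kernel_of.
Proof.
split; first by apply/asboolP; rewrite raddf0.
by move=> x y /asboolP x0 /asboolP y0; apply/asboolP; rewrite raddfB x0 y0 subr0.
Qed.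

HB.instance Definition _ := GRing.isZmodClosed.Build G image_of image_of_closed.
HB.instance Definition _ :=
  GRing.isZmodClosed.Build G kernel_of kernel_of_closed.

End EndoSubgroups.

Section MultipleSubgroups.
Variables (G : zmodType) (a : int).

Definition multiples_of : {pred G} := fun y => `[< exists g, y = g *~ a >].

Definition annihilated_by : {pred G} := fun g => `[< g *~ a = 0 >].

Lemma multiples_of_closed : zmod_closed multiples_of.
Proof.
split; first by apply/asboolP; exists 0; rewrite mul0rz.
move=> _ _ /asboolP[x ->] /asboolP[y ->].
by apply/asboolP; exists (x - y); rewrite mulrzBl.
Qed.

Lemma annihilated_by_closed : zmod_closed annihilated_by.
Proof.
split; first by apply/asboolP; rewrite mul0rz.
by move=> x y /asboolP x0 /asboolP y0; apply/asboolP; rewrite mulrzBl x0 y0 subr0.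
Qed.

HB.instance Definition _ :=
  GRing.isZmodClosed.Build G multiples_of multiples_of_closed.
HB.instance Definition _ :=
  GRing.isZmodClosed.Build G annihilated_by annihilated_by_closed.

End MultipleSubgroups.

Arguments multiples_of : clear implicits.
Arguments annihilated_by : clear implicits.

Definition morphic (G : zmodType) : Prop :=
  forall alpha : {additive G -> G},
    isomorphic {ideal_quot (image_of alpha)} (subgroup_type (kernel_of alpha)).

Definition weakly_morphic (G : zmodType) : Prop :=
  forall a : int,
    isomorphic {ideal_quot (multiples_of G a)}
               (subgroup_type (annihilated_by G a)).

Definition has_order (G : zmodType) (g : G) (m : nat) : Prop :=
  [/\ (0 < m)%N, g *+ m = 0 &
      forall j : nat, (0 < j)%N -> g *+ j = 0 -> (m <= j)%N].

Section PrimaryComponent.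
Variables (G : zmodType) (p : nat).

Definition order_power_of (g : G) : Prop := exists e : nat, has_order g (p ^ e).

Lemma order_power_ofP (p_prime : prime p) (g : G) :
  order_power_of g <-> exists e : nat, g *+ (p ^ e) = 0.
Proof.
split=> [[e [_ ge _]]|]; first by exists e.
move=> ex; have ex' : exists e, g *+ (p ^ e) == 0.
  by case: ex => e /eqP; exists e.
case: (ex_minnP ex') => e /eqP ge emin; exists e; split=> //.
  by rewrite expn_gt0 prime_gt0.
move=> j j0 gj.
have gd : g *+ gcdn j (p ^ e) = 0.
  case: (egcdnP (p ^ e) j0) => u v eq_uv _.
  have : g *+ (u * j) = 0 by rewrite mulnC mulrnA gj mul0rn.
  by rewrite eq_uv mulrnDr mulnC mulrnA ge mul0rn add0r.
have /(dvdn_pfactor _ _ p_prime)[d le_de gcdE] := dvdn_gcdr j (p ^ e).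
have le_ed : (e <= d)%N by apply: emin; rewrite -gcdE gd.
have eq_de : d = e by apply/eqP; rewrite eqn_leq le_de.
by apply: dvdn_leq => //; rewrite -eq_de -gcdE dvdn_gcdl.
Qed.

(* The unused primality proof is kept as an argument because the predicate is
   a subgroup only for such p. *)
Definition primary_component of prime p : {pred G} :=
  fun g => `[< order_power_of g >].

Variable p_prime : prime p.

Lemma primary_component_closed : zmod_closed (primary_component p_prime).
Proof.
split; first by apply/asboolP/order_power_ofP => //; exists 0; rewrite mul0rn.
move=> x y /asboolP/(order_power_ofP p_prime)[d xd].
move=> /asboolP/(order_power_ofP p_prime)[e ye].
apply/asboolP/order_power_ofP => //; exists (d + e)%N.
by rewrite mulrnBl expnD mulrnA xd mul0rn mulnC mulrnA ye mul0rn subr0.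
Qed.

HB.instance Definition _ :=
  GRing.isZmodClosed.Build G (primary_component p_prime)
    primary_component_closed.

End PrimaryComponent.

Arguments primary_component G {p} p_prime.

(* 'I_m.+1 is the cyclic group of order m.+1, so 'I_(p ^ k).-1.+1 is the cyclic
   group of order p ^ k, trivial for k = 0; 'Z_(p ^ k) would have two elements
   in that case. *)
Definition homogeneous_group (p k n : nat) : zmodType :=
  {ffun 'I_n -> 'I_(p ^ k).-1.+1}.

(* Main.v *)
From HB Require Import structures.
From mathcomp Require Import all_boot all_order all_algebra.
From mathcomp Require Import all_fingroup all_solvable.
From mathcomp Require Import boolp.
Require Import Defs.

(** Call an abelian group [A] killed by [N] exact at [N] ([mul_exact]) when
    [dA = A[e]] for every factorisation [N = d * e], where [A[e]] is the
    [e]-torsion.  The theorem holds because, for a finite group of exponent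
    [N], being morphic, being exact at [N], and having homogeneous primary
    components are the same thing.

    Finiteness comes from the weak property.  Choose a maximal independent
    subfamily [l] of the generators; some [N > 0] multiplies [G] into the span
    of [l], so torsion elements are killed by [N] and multiplication by [N + 1]
    is injective.  A weakly morphic [G] then equals [(N + 1)G], which is absurd
    if [l] has an element [x]: the relation [N x = (N + 1) N h] would make
    [N + 1] divide [N].  Hence [l] is empty and [N] kills [G].

    For finite groups everything is counting.  A finite abelian group is
    determined up to isomorphism by the numbers [|A[m]|] (split off a cyclic
    summand of maximal order and induct).  Counting the elements [x] with
    [m x] in [alpha F] in two ways gives
    [|alpha F| * |(F / alpha F)[m]| = |F[m]| * |mF \cap alpha F|], so [F] is
    morphic if and only if
    [|alpha F| * |ker alpha \cap F[m]| = |F[m]| * |mF \cap alpha F|]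
    for all [alpha] and [m] ([isomorphic_coker_kerP]).

    If [F] is exact at [N], this identity follows by counting the kernel of
    [m' alpha = alpha m'] in two ways, where [N = m m'].  Conversely, let
    [N = d e] be the exponent and [e y = 0].  Sending a cyclic summand of order
    [N] onto the multiples of [y] and its complement to [0] gives an
    endomorphism [alpha] that kills [F[d]]; the identity for [m = d] collapses
    to [alpha F <= dF], so [y] is in [dF].

    Finally exactness at [N] is exactness of each [p]-component at the [p]-part
    of [N], and a [p]-group exact at [p^k] has [|A[p^i]| = |A[p]|^i] for
    [i <= k], the same counts as a power of a cyclic group of order [p^k]. *)

Set Implicit Arguments.
Unset Strict Implicit.
Unset Printing Implicit Defensive.

Import Order.TTheory GRing.Theory Num.Theory.

(** * Finite abelian groups are determined by torsion counts *)

Section AbelianGroups.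
Local Open Scope group_scope.
Implicit Types gT rT : finGroupType.

Lemma abelian_exponent_summand gT (G : {group gT}) :
  abelian G -> exists (x : gT) (H : {group gT}),
    #[x] = exponent G /\ <[x]> \x H = G.
Proof.
move=> cGG; have [x Gx ox] := exponent_witness (abelian_nil cGG).
have /splitsP[H /complP[tixH defG]] := abelian_splits Gx (esym ox) cGG.
exists x, H; split=> //; rewrite dprodE // (sub_abelian_cent2 cGG) ?cycle_subG //.
by rewrite -defG mulG_subr.
Qed.

Lemma card_Ldiv_dprod gT (K H G : {group gT}) n :
  abelian G -> K \x H = G ->
  #|'Ldiv_n(G)| = (#|'Ldiv_n(K)| * #|'Ldiv_n(H)|)%N.
Proof.
move=> cGG /dprodP[_ defG cKH tiKH].
have sKG : K \subset G by rewrite -defG mulG_subl.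
have sHG : H \subset G by rewrite -defG mulG_subr.
pose LK := Group (group_Ldiv n (abelianS sKG cGG)).
pose LH := Group (group_Ldiv n (abelianS sHG cGG)).
have tiL : LK :&: LH = 1.
  by apply/trivgP; rewrite -tiKH setISS ?subsetIl.
rewrite -(TI_cardMg tiL); congr #|pred_of_set _|; apply/setP=> z.
apply/LdivP/mulsgP=> [[Gz zn] | [x y /LdivP[Kx xn] /LdivP[Hy yn] ->]].
  have [x y Kx Hy defz] : imset2_spec mulg (mem K) (fun=> mem H) z.
    by apply/mulsgP; rewrite defG.
  have cxy : commute x y by apply/commute_sym/(centsP cKH).
  have xyn : x ^+ n * y ^+ n = 1 by rewrite -expgMn // -defz.
  have xn : x ^+ n = 1.
    apply/set1gP; rewrite -tiKH inE groupX //=.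
    by rewrite (canRL (mulgK _) xyn) mul1g groupV groupX.
  have yn : y ^+ n = 1 by rewrite xn mul1g in xyn.
  by exists x y => //; apply/LdivP.
have cxy : commute x y.
  by apply: (centsP cGG); [apply: (subsetP sKG)|apply: (subsetP sHG)].
by rewrite expgMn // xn yn mulg1 -defG mem_mulg.
Qed.

Lemma card_Ldiv_isog gT rT (G : {group gT}) (H : {group rT}) n :
  G \isog H -> #|'Ldiv_n(G)| = #|'Ldiv_n(H)|.
Proof.
case/isogP=> f injf <-.
by rewrite -injm_Ldiv // card_injm ?subsetIl.
Qed.

Lemma exponent_dvd_Ldiv gT (G : {group gT}) n :
  (exponent G %| n) = (#|'Ldiv_n(G)| == #|G|).
Proof.
rewrite -sub_Ldiv; have [_ ->] := subset_leqif_cards (subsetIl G 'Ldiv_n()).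
by rewrite eqEsubset subsetIl.
Qed.

(** The counts determine the exponent, hence a cyclic direct factor of that
    order on each side; dividing its contribution out of the counts leaves the
    hypothesis for the two complements. *)
Lemma isog_Ldiv gT rT (G : {group gT}) (H : {group rT}) :
  abelian G -> abelian H -> (forall n, #|'Ldiv_n(G)| = #|'Ldiv_n(H)|) ->
  G \isog H.
Proof.
have [m] := ubnP #|G|; elim: m gT rT G H => // m IHm gT rT G H leGm cGG cHH eqL.
(* [n = 0] recovers the order, since every element satisfies [x ^+ 0 = 1]. *)
have Ldiv0 T (K : {group T}) : 'Ldiv_0(K) = K.
  by apply/setIidPl/subsetP=> z; rewrite inE.
have eqGH : #|G| = #|H| by rewrite -(Ldiv0 _ G) -(Ldiv0 _ H).
have [G1 | ntG] := eqsVneq G 1.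
  have H1 : H :=: 1 by apply/card1_trivg; rewrite -eqGH G1 cards1.
  exact: trivial_isog.
have eq_exp : exponent G = exponent H.
  apply/eqP; rewrite eqn_dvd !exponent_dvd_Ldiv eqL eqGH -exponent_dvd_Ldiv.
  by rewrite -eqL -eqGH -exponent_dvd_Ldiv !dvdnn.
have [x [G' [ox defG]]] := abelian_exponent_summand cGG.
have [y [H' [oy defH]]] := abelian_exponent_summand cHH.
have iso_xy : <[x]> \isog <[y]>.
  by rewrite isog_cyclic_card ?cycle_cyclic //= -!orderE ox oy eq_exp eqxx.
have x_gt1 : 1 < #[x].
  by rewrite ox ltn_neqAle exponent_gt0 eq_sym -dvdn1 -trivg_exponent ntG.
have sG'G : G' \subset G by have [_ <- _ _] := dprodP defG; apply: mulG_subr.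
have sH'H : H' \subset H by have [_ <- _ _] := dprodP defH; apply: mulG_subr.
apply: (isog_dprod defG defH iso_xy); apply: IHm => [|||n].
- rewrite -ltnS; apply: leq_trans leGm; rewrite ltnS -(dprod_card defG) -orderE.
  by rewrite ltn_Pmull ?cardG_gt0.
- exact: abelianS cGG.
- exact: abelianS cHH.
have := eqL n; rewrite (card_Ldiv_dprod n cGG defG) (card_Ldiv_dprod n cHH defH).
rewrite (card_Ldiv_isog n iso_xy) => /eqP; rewrite eqn_pmul2l => [/eqP //|].
by apply/card_gt0P; exists 1; apply/LdivP; rewrite group1 expg1n.
Qed.

(** The morphism sends a generator [x] of a cyclic factor of maximal order to
    [y] and a complement to [1].  An element [x ^+ i * h] killed by [m] has
    [m * e] dividing [i * m], so [e] divides [i] and its image [y ^+ i] is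
    trivial. *)
Lemma morphism_onto_element gT (G : {group gT}) (m e : nat) y :
  abelian G -> exponent G = (m * e)%N -> y \in G -> y ^+ e = 1 ->
  exists f : {morphism G >-> gT}, y \in f @* G /\ {in 'Ldiv_m(G), forall z, f z = 1}.
Proof.
move=> cGG expG Gy ye; have [x [H [ox defG]]] := abelian_exponent_summand cGG.
have [_ mulG _ _] := dprodP defG.
have sxG : <[x]> \subset G by rewrite -mulG mulG_subl.
have dvd_yx : #[y] %| #[x] by rewrite ox dvdn_exponent.
pose fx := eltm_morphism dvd_yx; pose fH := [morphism of @trivm gT gT H].
have cxH : fH @* H \subset 'C(fx @* <[x]>) by rewrite morphim_trivm sub1G.
pose f := dprodm_morphism defG cxH.
have fE i h : h \in H -> f (x ^+ i * h) = y ^+ i.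
  move=> Hh; rewrite /= dprodmE ?mem_cycle // /trivm mulg1.
  exact: (eltmE dvd_yx).
exists f; split.
  have Gx : x \in G by apply: (subsetP sxG); apply: cycle_id.
  apply/morphimP; exists x => //; rewrite -{1}[x]mulg1 -[x]expg1.
  by rewrite fE ?group1.
move=> z /LdivP[]; rewrite -{1}mulG => /mulsgP[_ h /cycleP[i ->] Hh ->].
have [_ _ cxH' tixH] := dprodP defG.
have cxh : commute (x ^+ i) h by apply/commute_sym/(centsP cxH'); rewrite ?mem_cycle.
rewrite expgMn // -expgM fE // => /(canRL (mulgK _)); rewrite mul1g => xim.
have : x ^+ (i * m) == 1.
  by apply/eqP/set1gP; rewrite -tixH inE mem_cycle /= xim groupV groupX.
rewrite -order_dvdn ox expG mulnC dvdn_pmul2r => [/dvdnP[j ->]|].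
  by rewrite mulnC expgM ye expg1n.
by have := exponent_gt0 G; rewrite expG muln_gt0 => /andP[].
Qed.

End AbelianGroups.

Local Open Scope ring_scope.

(** * Finite Z-modules as finite groups *)

(** Equality of structures, and not only an isomorphism, lets a statement
    about an abstract finite group be specialised to a [finZmodType] by
    substitution. *)
Lemma finite_zmodP (G : zmodType) (s : seq G) :
  (forall x, x \in s) -> exists F : finZmodType, G = F.
Proof.
move=> s_all.
have fK : pcancel (fun x => index x s) (fun i => nth None (map Some s) i).
  move=> x; rewrite (nth_map x) ?index_mem ?s_all //.
  by rewrite nth_index ?s_all.
have axiomT : Finite.axiom (undup s).
  by move=> x; rewrite count_uniq_mem ?undup_uniq // mem_undup s_all.
pose F : finZmodType := HB.pack_for finZmodType (GRing.Zmodule.sort G)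
  (PCanIsCountable fK) (isFinite.Build G axiomT).
(* Destructing [G] makes the repacked structure convertible to it. *)
exists F; case: G s s_all fK axiomT @F => T c s s_all fK axiomT F.
reflexivity.
Qed.

Lemma mem_subgroup_enum (F : finZmodType) (S : zmodClosed F)
    (u : subgroup_type S) :
  u \in (pmap insub (enum F) : seq (subgroup_type S)).
Proof. by rewrite mem_pmap_sub mem_enum. Qed.

Lemma additive_of_morphism (A B : finZmodType) (f : {morphism [set: A] >-> B}) :
  exists g : {additive A -> B}, g =1 f.
Proof.
have fD x y : f (x + y) = f x + f y.
  by apply: (morphM f (in_setT x) (in_setT y)).
have f_add : zmod_morphism f.
  by move=> x y; apply: (addIr (f y)); rewrite -fD !subrK.
pose g : {additive A -> B} := HB.pack_for {additive A -> B} (f : A -> B)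
  (GRing.isZmodMorphism.Build A B f f_add).
by exists g.
Qed.

Lemma isomorphic_isog (A B : finZmodType) :
  [set: A]%G \isog [set: B]%G -> isomorphic A B.
Proof.
case/isogP=> f injf imf; have [g gE] := additive_of_morphism f.
exists g; apply: inj_card_bij.
  by move=> x y; rewrite !gE; apply: (injmP injf); rewrite inE.
by have := card_injm injf (subxx _); rewrite imf !cardsT => ->.
Qed.

Definition torsion (A : finZmodType) n : {set A} := [set x | x *+ n == 0].

Definition kernel_set (A B : finZmodType) (f : A -> B) := [set x | f x == 0].

Lemma torsion_Ldiv (A : finZmodType) n : torsion A n = 'Ldiv_n([set: A]%G)%g.
Proof. by apply/setP=> x; rewrite !inE FinRing.zmodXgE. Qed.

Lemma isomorphic_torsion (A B : finZmodType) :
  (forall n, #|torsion A n| = #|torsion B n|) -> isomorphic A B.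
Proof.
move=> eqAB; apply/isomorphic_isog/isog_Ldiv => [||n];
  rewrite ?FinRing.zmod_abelian //.
by rewrite -!torsion_Ldiv.
Qed.

Lemma card_torsion_isomorphic (A B : finZmodType) n :
  isomorphic A B -> #|torsion A n| = #|torsion B n|.
Proof.
case=> f f_bij; have f_inj := bij_inj f_bij.
rewrite -(on_card_preimset (f := f)); last exact: onW_bij.
by apply: eq_card => x; rewrite !inE -raddfMn (raddf_eq0 _ f_inj).
Qed.

(** * Multiplication by an integer and exactness *)

Section Multiplication.
Variable A : zmodType.

(** Named so that multiplication by [n] carries a canonical additive structure. *)
Definition mulrn_by (n : nat) (x : A) := x *+ n.

Lemma mulrn_by_is_zmod_morphism n : zmod_morphism (mulrn_by n).
Proof. by move=> x y; rewrite /mulrn_by mulrnBl. Qed.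

HB.instance Definition _ n :=
  GRing.isZmodMorphism.Build A A (mulrn_by n) (mulrn_by_is_zmod_morphism n).

End Multiplication.

(** For [d * e = N] the sequence [A -> A -> A] of multiplications by [d] and
    then by [e] is exact in the middle: [dA = A[e]].  By Baer's criterion
    this says that [A] is an injective module over the integers modulo [N]. *)
Definition mul_exact (A : zmodType) (N : nat) : Prop :=
  (forall x : A, x *+ N = 0) /\
  forall d e : nat, (d * e = N)%N -> forall y : A, y *+ e = 0 ->
    exists z, y = z *+ d.

Lemma mulrn_gcdn (A : zmodType) N n (x : A) :
  (0 < N)%N -> x *+ N = 0 -> exists k, x *+ gcdn n N = - x *+ (k * n).
Proof.
move=> N0 xN; case: (egcdnP n N0) => u v eq_uv _; exists v; rewrite gcdnC.
have : x *+ (u * N) = 0 by rewrite mulnC mulrnA xN mul0rn.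
by rewrite eq_uv mulrnDr addrC mulNrn => /eqP; rewrite addr_eq0 => /eqP.
Qed.

Lemma mulrn_gcdn_eq0 (A : zmodType) m n (x : A) :
  x *+ m = 0 -> x *+ n = 0 -> x *+ gcdn m n = 0.
Proof.
case: n => [|n] xm xn; first by rewrite gcdn0.
have [k ->] := mulrn_gcdn m (ltn0Sn n) xn.
by rewrite mulnC mulrnA mulNrn xm oppr0 mul0rn.
Qed.

Lemma torsion_gcdn (A : finZmodType) N n :
  (forall x : A, x *+ N = 0) -> torsion A n = torsion A (gcdn n N).
Proof.
move=> killA; apply/setP=> x; rewrite !inE; apply/eqP/eqP=> [nx|gx].
  exact: mulrn_gcdn_eq0.
by have /dvdnP[c ->] := dvdn_gcdl n N; rewrite mulnC mulrnA gx mul0rn.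
Qed.

Lemma multiples_gcdn (A : finZmodType) N n :
  (0 < N)%N -> (forall x : A, x *+ N = 0) ->
  mulrn_by n @: [set: A] = mulrn_by (gcdn n N) @: [set: A].
Proof.
move=> N0 killA; apply/setP=> y; apply/imsetP/imsetP=> -[x _ ->].
  have /dvdnP[c nE] := dvdn_gcdl n N; exists (x *+ c); rewrite ?inE //.
  by rewrite /mulrn_by -mulrnA -nE.
have [k gx] := mulrn_gcdn n N0 (killA x).
by exists (- x *+ k); rewrite ?inE // /mulrn_by gx mulrnA.
Qed.

Lemma multiples_torsion (F : finZmodType) N m m' :
  mul_exact F N -> (m * m' = N)%N -> mulrn_by m @: [set: F] = torsion F m'.
Proof.
move=> [killF exF] mm'; apply/setP=> y; rewrite inE; apply/imsetP/eqP.
  by case=> x _ ->; rewrite -mulrnA mm'.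
by case/(exF _ _ mm')=> z ->; exists z; rewrite ?inE.
Qed.

Lemma exact_isomorphic (A B : zmodType) N :
  isomorphic A B -> mul_exact B N -> mul_exact A N.
Proof.
case=> f [g fK gK] [killB exB]; have f_inj := can_inj fK.
split=> [a|d e de y ye].
  by apply: f_inj; rewrite raddfMn killB raddf0.
have [|z fy] := exB d e de (f y); first by rewrite -raddfMn ye raddf0.
by exists (g z); apply: f_inj; rewrite raddfMn gK.
Qed.

Lemma exact_cyclic_power m n : mul_exact {ffun 'I_n -> 'I_m.+1} m.+1.
Proof.
split=> [x|d e de y ye].
  apply/ffunP=> i; rewrite ffunMnE ffunE Zp_mulrn; apply: val_inj.
  by rewrite /= modnMl.
have d_dvd i : (d %| y i)%N.
  have e0 : (0 < e)%N by move: (ltn0Sn m); rewrite -de muln_gt0 => /andP[].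
  rewrite -(dvdn_pmul2r e0) de; have /ffunP/(_ i) := ye.
  by rewrite ffunMnE ffunE Zp_mulrn => /(congr1 val)/eqP.
exists [ffun i => inZp (y i %/ d)%N]; apply/ffunP=> i.
rewrite ffunMnE ffunE Zp_mulrn; apply: val_inj.
by rewrite /= modnMml divnK // modn_small.
Qed.

(** * Counting kernels and cokernels *)

(** Each non-empty fibre is a coset of the kernel.  The kernel and
    cokernel counts below all reduce to it. *)
Lemma card_preim_additive (A B : finZmodType) (f : {additive A -> B})
    (S : {set B}) :
  #|f @^-1: S| = (#|kernel_set f| * #|f @: [set: A] :&: S|)%N.
Proof.
have fI x : f x \in f @: [set: A] by rewrite imset_f ?inE.
rewrite -sum1_card (partition_big f [pred y in f @: [set: A] :&: S]) /=; last first.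
  by move=> x; rewrite !inE fI => ->.
rewrite mulnC -sum_nat_const; apply: eq_bigr => _ /setIP[/imsetP[x0 _ ->] Sx0].
rewrite sum1_card -(card_imset (kernel_set f) (addrI x0)); apply: eq_card => x.
apply/idP/imsetP=> [|[k]].
  rewrite [x \in _]unfold_in /= => /andP[_ /eqP eqf].
  exists (x - x0); last by rewrite addrC subrK.
  by rewrite inE raddfB eqf subrr.
by rewrite !inE => /eqP fk ->; rewrite unfold_in /= inE raddfD fk addr0 Sx0 eqxx.
Qed.

Lemma card_kernel_image (A B : finZmodType) (f : {additive A -> B}) :
  (#|kernel_set f| * #|f @: [set: A]| = #|A|)%N.
Proof.
by rewrite -[f @: _](setIT) -card_preim_additive preimsetT cardsT.
Qed.

Section CokernelKernel.
Variables (F : finZmodType) (alpha : {additive F -> F}).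

(** Both sides count the [x] with [x *+ m] in the image of [alpha]: as the
    preimage under [pi] of the [m]-torsion of the cokernel, and as the preimage
    of the image of [alpha] under multiplication by [m]. *)
Lemma card_torsion_coker (A : finZmodType) (pi : {additive F -> A}) m :
  (forall a, exists x, pi x = a) ->
  (forall x, pi x = 0 <-> exists z, alpha z = x) ->
  (#|alpha @: [set: F]| * #|torsion A m| =
   #|torsion F m| * #|mulrn_by m @: [set: F] :&: alpha @: [set: F]|)%N.
Proof.
move=> pi_surj pi_ker.
have -> : torsion F m = kernel_set (@mulrn_by F m) by [].
have <- : kernel_set pi = alpha @: [set: F].
  apply/setP=> x; rewrite inE; apply/eqP/imsetP=> [/pi_ker[z <-]|[z _ ->]].
    by exists z; rewrite ?inE.
  by apply/pi_ker; exists z.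
have piT : pi @: [set: F] = [set: A].
  by apply/setP=> a; have [x <-] := pi_surj a; rewrite imset_f inE.
rewrite -(card_preim_additive (@mulrn_by F m)) -[torsion A m](setTI) -piT.
rewrite -card_preim_additive; congr #|pred_of_set _|.
by apply/setP=> x; rewrite !inE -raddfMn.
Qed.

Lemma card_torsion_ker (B : finZmodType) (iota : {additive B -> F}) m :
  injective iota -> (forall x, (exists u, iota u = x) <-> alpha x = 0) ->
  #|torsion B m| = #|kernel_set alpha :&: torsion F m|.
Proof.
move=> iota_inj iota_im; rewrite -(card_imset _ iota_inj); apply: eq_card => y.
apply/imsetP/setIP=> [[u um ->]|[]]; rewrite !inE.
  by split; [apply/eqP/iota_im; exists u|
    rewrite -raddfMn (raddf_eq0 _ iota_inj); rewrite inE in um].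
move=> /eqP/iota_im[u <-]; rewrite -raddfMn (raddf_eq0 _ iota_inj) => um.
by exists u; rewrite ?inE.
Qed.

(** The cokernel and kernel are abstract here, so that they can be replaced by
    equal [finZmodType] structures. *)
Lemma isomorphic_exact_torsion (Q K : zmodType) (pi : {additive F -> Q})
    (iota : {additive K -> F}) (sK : seq K) :
  (forall u, u \in sK) ->
  (forall a, exists x, pi x = a) ->
  (forall x, pi x = 0 <-> exists z, alpha z = x) ->
  injective iota -> (forall x, (exists u, iota u = x) <-> alpha x = 0) ->
  isomorphic Q K <-> forall m,
    (#|alpha @: [set: F]| * #|kernel_set alpha :&: torsion F m| =
     #|torsion F m| * #|mulrn_by m @: [set: F] :&: alpha @: [set: F]|)%N.
Proof.
move=> sK_all pi_surj pi_ker iota_inj iota_im.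
have [B eqB] := finite_zmodP sK_all.
have [A eqA] : exists A : finZmodType, Q = A.
  apply: (@finite_zmodP Q [seq pi x | x <- enum F]) => a.
  by have [x <-] := pi_surj a; rewrite map_f ?mem_enum.
subst Q K; have im0 : (0 < #|alpha @: [set: F]|)%N.
  by apply/card_gt0P; exists (alpha 0); rewrite imset_f ?inE.
split=> [isoAB m | eq_cards].
  rewrite -(card_torsion_ker m iota_inj iota_im).
  by rewrite -(card_torsion_isomorphic m isoAB) (card_torsion_coker m pi_surj).
apply: isomorphic_torsion => m; apply/eqP; rewrite -(eqn_pmul2l im0).
rewrite (card_torsion_coker m pi_surj) // (card_torsion_ker m iota_inj) //.
by rewrite eq_cards.
Qed.

Lemma isomorphic_coker_kerP :
  isomorphic {ideal_quot (image_of alpha)} (subgroup_type (kernel_of alpha)) <->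
  forall m,
    (#|alpha @: [set: F]| * #|kernel_set alpha :&: torsion F m| =
     #|torsion F m| * #|mulrn_by m @: [set: F] :&: alpha @: [set: F]|)%N.
Proof.
pose Q := {ideal_quot (image_of alpha)}; pose K := subgroup_type (kernel_of alpha).
pose pi : {additive F -> Q} := \pi_{ideal_quot (image_of alpha)}%qT.
pose iota : {additive K -> F} := val.
apply: (@isomorphic_exact_torsion Q K pi iota (pmap insub (enum F))).
- exact: mem_subgroup_enum.
- by move=> a; exists (generic_quotient.repr a); apply: reprK.
- move=> x; have piE : (pi x == pi 0) = (x - 0 \in image_of alpha).
    by rewrite Quotient.idealrBE.
  rewrite -[X in _ = X](raddf0 pi); split=> [/eqP|[z zx]].
    by rewrite piE subr0 => /asboolP.
  by apply/eqP; rewrite piE subr0; apply/asboolP; exists z.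
- exact: val_inj.
move=> x; split=> [[u <-]|x0]; first by have /asboolP := valP u.
have kx : x \in kernel_of alpha by apply/asboolP.
by exists (exist _ x kx : K).
Qed.

(** After replacing [m] by [d = gcdn m N] and writing [N = d * m'], exactness
    turns multiples into torsion.  The kernel of [alpha] composed with [m'] is
    counted twice, by applying [alpha] first and by applying [m'] first
    ([card_comp]); the rest is [|F[d]| * |F[m']| = |F|] and the cancellation of
    [|ker alpha|]. *)
Lemma card_image_kernel_exact N m :
  (0 < N)%N -> mul_exact F N ->
  (#|alpha @: [set: F]| * #|kernel_set alpha :&: torsion F m| =
   #|torsion F m| * #|mulrn_by m @: [set: F] :&: alpha @: [set: F]|)%N.
Proof.
move=> N0 exF; have [killF _] := exF.
rewrite (torsion_gcdn m killF) (multiples_gcdn m N0 killF).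
have [m' NE] := dvdnP (dvdn_gcdr m N); set d := gcdn m N in NE *.
have dm' : (d * m' = N)%N by rewrite mulnC.
rewrite (multiples_torsion exF dm').
have cardF : (#|torsion F d| * #|torsion F m'| = #|F|)%N.
  by rewrite -(multiples_torsion exF dm') -(card_kernel_image (@mulrn_by F d)).
have card_comp : (#|kernel_set alpha| * #|alpha @: [set: F] :&: torsion F m'| =
    #|torsion F m'| * #|torsion F d :&: kernel_set alpha|)%N.
  rewrite -(multiples_torsion exF (esym NE)).
  rewrite -(card_preim_additive (@mulrn_by F m')) -card_preim_additive.
  by apply: eq_card => x; rewrite !inE /mulrn_by raddfMn.
have K0 : (0 < #|kernel_set alpha|)%N.
  by apply/card_gt0P; exists 0; rewrite inE raddf0.
apply/eqP; rewrite -(eqn_pmul2l K0) mulnA card_kernel_image -cardF.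
by rewrite -mulnA setIC -card_comp mulnCA [_ :&: torsion F m']setIC.
Qed.

End CokernelKernel.

(** * Finite morphic groups are the exact ones *)

Lemma morphic_of_exact (F : finZmodType) N :
  (0 < N)%N -> mul_exact F N -> morphic F.
Proof.
move=> N0 exF alpha; apply/isomorphic_coker_kerP => m.
exact: card_image_kernel_exact exF.
Qed.

(** The endomorphism of [morphism_onto_element] contains [F[d]] in its kernel,
    so the counting identity at [m = d] forces its image, which contains [y],
    into [dF]. *)
Lemma exact_of_morphic (F : finZmodType) :
  morphic F -> mul_exact F (exponent [set: F]).
Proof.
move=> morF; split=> [x|d e de y ye].
  by rewrite -FinRing.zmodXgE expg_exponent ?inE.
have [f [yf f_tors]] := morphism_onto_element (FinRing.zmod_abelian _)
  (esym de) (in_setT y) ye.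
have [alpha alphaE] := additive_of_morphism f.
have sTK : torsion F d \subset kernel_set alpha.
  apply/subsetP=> z; rewrite torsion_Ldiv => zd; rewrite inE alphaE; apply/eqP.
  by apply: f_tors.
have t0 : (0 < #|torsion F d|)%N.
  by apply/card_gt0P; exists 0; rewrite inE mul0rn.
have /isomorphic_coker_kerP/(_ d)/eqP := morF alpha.
rewrite mulnC (setIidPr sTK) eqn_pmul2l // eq_sym => /eqP eq_im.
have /subset_cardP/(_ (subsetIr _ _)) im_sub := eq_im.
have : y \in alpha @: [set: F].
  by have /morphimP[x _ _ ->] := yf; rewrite -alphaE imset_f ?inE.
by rewrite -im_sub => /setIP[/imsetP[z _ ->] _]; exists z.
Qed.

(** * Exact p-groups are homogeneous *)

(** Multiplication by [p] maps [A[p^(i+1)]] onto [A[p^i]], because [A[p^i]] lies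
    in [A[p^(k-1)] = pA]; its kernel is [A[p]]. *)
Lemma card_torsion_expn (A : finZmodType) p k i :
  (0 < p)%N -> mul_exact A (p ^ k) -> (i <= k)%N ->
  #|torsion A (p ^ i)| = (#|torsion A p| ^ i)%N.
Proof.
move=> p0 exA; elim: i => [|i IHi] lt_ik.
  by apply/eqP/cards1P; exists 0; apply/setP=> x; rewrite !inE.
rewrite [RHS]expnS -(IHi (ltnW lt_ik)).
have -> : torsion A (p ^ i.+1) = @mulrn_by A p @^-1: torsion A (p ^ i).
  by apply/setP=> x; rewrite !inE /mulrn_by -mulrnA -expnS.
have pk : (p * p ^ k.-1 = p ^ k)%N by rewrite -expnS (ltn_predK lt_ik).
rewrite card_preim_additive (multiples_torsion exA pk).
congr (_ * #|pred_of_set _|)%N; apply/setIidPr/subsetP=> x; rewrite !inE => /eqP xi.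
have le_ik : (i <= k.-1)%N by rewrite -ltnS (ltn_predK lt_ik).
by rewrite -(subnKC le_ik) expnD mulrnA xi mul0rn.
Qed.

(** All torsion counts are powers of [|A[p]|], and [|A| = |A[p]|^k]. *)
Lemma isomorphic_exact_card (A B : finZmodType) p k : prime p ->
  mul_exact A (p ^ k) -> mul_exact B (p ^ k) -> #|A| = #|B| -> isomorphic A B.
Proof.
move=> p_pr exA exB eqAB; have p0 := prime_gt0 p_pr.
have pk0 : (0 < p ^ k)%N by rewrite expn_gt0 p0.
have tors_top (C : finZmodType) :
    mul_exact C (p ^ k) -> torsion C (p ^ k) = [set: C].
  by case=> killC _; apply/setP=> x; rewrite !inE killC eqxx.
apply: isomorphic_torsion => n.
rewrite (torsion_gcdn n (proj1 exA)) (torsion_gcdn n (proj1 exB)).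
have /(dvdn_pfactor _ _ p_pr)[i le_ik ->] := dvdn_gcdr n (p ^ k).
rewrite (card_torsion_expn p0 exA le_ik) (card_torsion_expn p0 exB le_ik).
(* For [i > 0] also [k > 0], and [k]-th powers of naturals are then injective. *)
case: i => // i in le_ik *; congr (_ ^ _)%N; apply/eqP.
have k0 : (0 < k)%N by apply: leq_trans le_ik.
rewrite -(eqn_exp2r _ _ k0) -(card_torsion_expn p0 exA (leqnn k)).
by rewrite -(card_torsion_expn p0 exB (leqnn k)) !tors_top // !cardsT eqAB.
Qed.

Lemma homogeneous_of_exact (A : finZmodType) p k : prime p ->
  mul_exact A (p ^ k) -> exists n, isomorphic A (homogeneous_group p k n).
Proof.
move=> p_pr exA; have p0 := prime_gt0 p_pr; have [killA _] := exA.
have pk0 : (0 < p ^ k)%N by rewrite expn_gt0 p0.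
have cardA : #|A| = (#|torsion A p| ^ k)%N.
  rewrite -(card_torsion_expn p0 exA (leqnn k)) -cardsT.
  by apply: eq_card => x; rewrite !inE killA eqxx.
have pA : (p.-group [set: A])%g.
  rewrite -pnat_exponent; apply: (@pnat_dvd _ (p ^ k)).
    2: by rewrite pnatX pnat_id.
  by apply/exponentP=> x _; rewrite FinRing.zmodXgE.
have [n cardAn] : exists n, #|A| = (p ^ (k * n))%N.
  (* For [k = 0] the group is trivial but the counts leave [|A[p]|] free. *)
  case: (posnP k) => [k0 | k0]; first by exists 0; rewrite cardA k0.
  have [l cardAl] := p_natP pA; rewrite cardsT in cardAl.
  have : (#|torsion A p| %| p ^ l)%N.
    by rewrite -cardAl cardA; apply: dvdn_exp.
  by case/(dvdn_pfactor _ _ p_pr)=> n _ tE; exists n; rewrite cardA tE -expnM mulnC.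
exists n.
pose H : finZmodType := HB.pack_for finZmodType (homogeneous_group p k n)
  (Finite.on {ffun 'I_n -> 'I_(p ^ k).-1.+1}).
have exH : mul_exact H (p ^ k).
  by have := exact_cyclic_power (p ^ k).-1 n; rewrite prednK.
apply: (isomorphic_exact_card (B := H) p_pr exA exH).
by rewrite cardAn card_ffun !card_ord prednK // expnM.
Qed.

(** * Exactness and primary components *)

Lemma mem_primary_component (G : zmodType) p (p_pr : prime p) (g : G) e :
  g *+ p ^ e = 0 -> g \in primary_component G p_pr.
Proof. by move=> ge; apply/asboolP/order_power_ofP => //; exists e. Qed.

(** If [N = N' * p^K] and [u] in the component is killed by [e], where
    [d * e = p^K], then [u = z * d * N'] in [G] and [z * N'] is back in the
    component. *)
Lemma exact_primary_component (G : zmodType) N p (p_pr : prime p) :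
  (0 < N)%N -> mul_exact G N ->
  mul_exact (subgroup_type (primary_component G p_pr)) (p ^ logn p N).
Proof.
move=> N0 [killG exG]; set P := subgroup_type _.
pose iota : {additive P -> G} := val.
have iota_inj : injective iota by exact: val_inj.
have [N' _ NE] := pfactor_coprime p_pr N0.
split=> [u|d e de u ue]; last first.
  have [||z zu] := exG (d * N')%N e _ (iota u).
  - by rewrite NE -de mulnAC mulnC.
  - by rewrite -raddfMn ue raddf0.
  have Pz : z *+ N' \in primary_component G p_pr.
    by apply: (@mem_primary_component _ _ _ _ (logn p N)); rewrite -mulrnA -NE.
  exists (exist _ (z *+ N') Pz : P); apply: iota_inj.
  by rewrite raddfMn zu mulnC mulrnA.
have /asboolP/(order_power_ofP p_pr)[e ue] := valP u.
apply: iota_inj; rewrite raddfMn raddf0.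
have /(dvdn_pfactor _ _ p_pr)[i _ gE] := dvdn_gcdl (p ^ e) N.
have le_i : (i <= logn p N)%N by rewrite -pfactor_dvdn // -gE dvdn_gcdr.
rewrite -(subnKC le_i) expnD mulrnA -gE.
by rewrite (mulrn_gcdn_eq0 ue (killG _)) mul0rn.
Qed.

(** For [e] a power of [p] the claim is exactness of the [p]-component at [p^k];
    minimality of [N] gives [K <= k] for the [p]-adic valuation [K] of [N], and
    the part of [N] prime to [p] acts invertibly.  For general [e], a Bezout
    relation splits [y] into parts killed by coprime factors of [e]. *)
Lemma exact_of_primary_components (G : zmodType) N :
  (0 < N)%N -> (forall x : G, x *+ N = 0) ->
  (forall M, (forall x : G, x *+ M = 0) -> (N %| M)%N) ->
  (forall p (p_pr : prime p), exists k,
     mul_exact (subgroup_type (primary_component G p_pr)) (p ^ k)) ->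
  mul_exact G N.
Proof.
move=> N0 killG minN exP.
have pfactor_case p i d y : prime p -> (d * p ^ i)%N = N -> y *+ p ^ i = 0 ->
    exists z : G, y = z *+ d.
  move=> p_pr dpi yi; have [k [killP exPk]] := exP p p_pr.
  set P := subgroup_type _ in killP exPk.
  pose iota : {additive P -> G} := val.
  have iota_inj : injective iota by exact: val_inj.
  have [N' coN' NE] := pfactor_coprime p_pr N0; set K := logn p N in NE.
  have p0 := prime_gt0 p_pr.
  have pi0 j : (0 < p ^ j)%N by rewrite expn_gt0 p0.
  have le_iK : (i <= K)%N by rewrite -pfactor_dvdn // -dpi dvdn_mull.
  have dE : d = (p ^ (K - i) * N')%N.
    apply/eqP; rewrite -(eqn_pmul2r (pi0 i)) dpi mulnAC -expnD subnK // mulnC.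
    by rewrite -NE.
  have N'0 : (0 < N')%N by move: N0; rewrite NE muln_gt0 => /andP[].
  (* [N'] maps [G] into the component, so [p ^ k * N'] kills [G]. *)
  have le_Kk : (K <= k)%N.
    rewrite -(dvdn_Pexp2l _ _ (prime_gt1 p_pr)) -(dvdn_pmul2l N'0) -NE.
    apply: minN => g; have Pg : g *+ N' \in primary_component G p_pr.
      by apply: (@mem_primary_component _ _ _ _ K); rewrite -mulrnA -NE.
    have := congr1 iota (killP (exist _ (g *+ N') Pg : P)).
    by rewrite raddfMn raddf0 mulrnA.
  have le_ik := leq_trans le_iK le_Kk.
  have Py := mem_primary_component p_pr yi.
  have [||w wE] := exPk (p ^ (k - i))%N (p ^ i)%N _ (exist _ y Py : P).
  - by rewrite -expnD subnK.
  - by apply: iota_inj; rewrite raddfMn raddf0.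
  have {wE} yE : y = iota w *+ p ^ (k - i) by rewrite -raddfMn -wE.
  set v := iota w *+ p ^ (k - K).
  have vK : v *+ p ^ K = 0.
    by rewrite -mulrnA -expnD subnK // -raddfMn killP raddf0.
  (* [N'] is invertible on elements killed by [p ^ K]: [v] is a multiple of
     [v *+ N']. *)
  have [a] := mulrn_gcdn N' (pi0 K) vK.
  rewrite (eqP (_ : coprime N' (p ^ K))) => [vE|]; last first.
    by rewrite coprime_sym coprimeXl.
  exists (- v *+ a); rewrite dE mulnC -!mulrnA mulnA mulrnA -vE mulr1n.
  by rewrite /v -mulrnA -expnD addnBA // subnK // -yE.
split=> // d e; have [m] := ubnP e; elim: m d e => // m IHm d e lt_em de y ye.
have e0 : (0 < e)%N by move: N0; rewrite -de muln_gt0 => /andP[].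
have [e1 | e_gt1] := leqP e 1.
  have -> : y = 0 by rewrite -ye (_ : e = 1%N) //; apply/eqP; rewrite eqn_leq e1.
  by exists 0; rewrite mul0rn.
have p_pr := pdiv_prime e_gt1; set p := pdiv e in p_pr.
have [e' co_e' eE] := pfactor_coprime p_pr e0; set i := logn p e in eE.
have i0 : (0 < i)%N by rewrite -pfactor_dvdn // expn1 pdiv_dvd.
have pi_gt1 : (1 < p ^ i)%N by rewrite -(exp1n i) ltn_exp2r ?prime_gt1.
have e'0 : (0 < e')%N by move: e0; rewrite eE muln_gt0 => /andP[].
have lt_e'm : (e' < m)%N.
  by rewrite -ltnS; apply: leq_trans lt_em; rewrite ltnS eE ltn_Pmulr.
case: (egcdnP (p ^ i) e'0) => u v eq_uv _.
have gcd1 : gcdn e' (p ^ i) = 1%N.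
  by apply/eqP; rewrite -/(coprime _ _) coprime_sym coprimeXl.
have [||s sE] := pfactor_case p i (d * e')%N (y *+ (u * e')) p_pr.
- by rewrite -de eE mulnA.
- by rewrite -mulrnA -mulnA -eE mulnC mulrnA ye mul0rn.
have [||t tE] := IHm (d * p ^ i)%N e' lt_e'm _ (y *+ (v * p ^ i)).
- by rewrite -de eE mulnAC mulnA.
- by rewrite -mulrnA -mulnA (mulnC _ e') -eE mulnC mulrnA ye mul0rn.
exists (s *+ e' - t *+ p ^ i).
rewrite mulrnBl -!mulrnA !(mulnC _ d) -sE -tE eq_uv gcd1 mulrnDr mulr1n.
by rewrite addrAC subrr add0r.
Qed.

(** * Weakly morphic finitely generated groups are finite *)

(** Recursion on the list, here and for independence, isolates the coefficient
    of one generator at a time, so that inductions need no coefficient vectors. *)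
Fixpoint in_span (G : zmodType) (l : seq G) (g : G) : Prop :=
  if l is x :: l' then exists m : int, in_span l' (g - x *~ m) else g = 0.

Fixpoint independent (G : zmodType) (l : seq G) : Prop :=
  if l is x :: l' then
    independent l' /\ forall m : int, in_span l' (x *~ m) -> m = 0
  else True.

Lemma in_span_mulrz (G : zmodType) (l : seq G) g (a : int) :
  in_span l g -> in_span l (g *~ a).
Proof.
elim: l g => [|x l IHl] g /=; first by move->; rewrite mul0rz.
by case=> m /IHl lm; exists (m * a); rewrite mulrzA -mulrzBl.
Qed.

Lemma in_spanD (G : zmodType) (l : seq G) g h :
  in_span l g -> in_span l h -> in_span l (g + h).
Proof.
elim: l g h => [|x l IHl] g h /=; first by move=> -> ->; rewrite addr0.
case=> m lm [n ln]; exists (m + n); rewrite mulrzDr opprD addrACA.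
exact: IHl.
Qed.

Lemma in_span0 (G : zmodType) (l : seq G) : in_span l 0.
Proof. by elim: l => //= x l IHl; exists 0; rewrite mulr0z subr0. Qed.

Lemma in_span_torsion_free (G : zmodType) (l : seq G) g (a : int) :
  independent l -> in_span l g -> a != 0 -> g *~ a = 0 -> g = 0.
Proof.
move=> + + a0; elim: l g => [|x l IHl] g //= [ind_l x_ind] [m lm] ga.
have m0 : m = 0.
  have := in_span_mulrz (- a) lm.
  rewrite mulrzBl mulrNz ga oppr0 sub0r mulrNz opprK -mulrzA => /x_ind/eqP.
  by rewrite mulf_eq0 (negPf a0) orbF => /eqP.
by rewrite m0 mulr0z subr0 in lm; apply: IHl.
Qed.

(** A generator that depends on [l] has a non-zero multiple in its span, which
    is absorbed into [N]; any other generator extends [l]. *)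
Lemma independent_subfamily (G : zmodType) (s : seq G) :
  exists (N : int) (l : seq G),
    [/\ N > 0, independent l & forall x, x \in s -> in_span l (x *~ N)].
Proof.
elim: s => [|x s [N [l [N0 ind_l sN]]]]; first by exists 1, [::].
have [[m [m0 lm]] | x_ind] := EM (exists m : int, m != 0 /\ in_span l (x *~ m)).
  (* The square makes the multiplier positive whatever the sign of [m]. *)
  exists (m ^+ 2 * N), l; split=> // [|y].
    by rewrite mulr_gt0 // exprn_even_gt0 // m0 orbT.
  rewrite inE => /orP[/eqP-> | /sN yN].
    by rewrite expr2 !mulrzA; do 2 apply: in_span_mulrz.
  by rewrite mulrC mulrzA; apply: in_span_mulrz.
exists N, (x :: l); split=> [//|/=|y].
  split=> // m lm; apply/eqP; apply: contraPT lm => m0 lm.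
  by apply: x_ind; exists m.
rewrite inE => /orP[/eqP-> | /sN yN] /=.
  by exists N; rewrite subrr; apply: in_span0.
by exists 0; rewrite mulr0z subr0.
Qed.

Lemma generators_in_span (G : zmodType) (s l : seq G) N :
  (forall g : G, exists c : 'I_(size s) -> int, g = \sum_(i < size s) s`_i *~ c i) ->
  (forall x, x \in s -> in_span l (x *~ N)) -> forall g : G, in_span l (g *~ N).
Proof.
move=> gen_s sN g; have [c ->] := gen_s g; rewrite mulrz_suml.
apply: big_ind => [|x y|i _]; [exact: in_span0 | exact: in_spanD |].
by rewrite mulrzAC; apply: in_span_mulrz; apply: sN; rewrite mem_nth.
Qed.

(** An element killed by [N + 1] is torsion, hence killed by [N], hence zero.
    Then [G / (N + 1)G], isomorphic to the [(N + 1)]-torsion, is trivial, so a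
    member [x] of the independent family is [(N + 1) h], and comparing the
    coefficients of [x] in [N x = (N + 1) (N h)] makes [N + 1] divide [N]. *)
Lemma bounded_of_weakly_morphic (G : zmodType) :
  finitely_generated G -> weakly_morphic G ->
  exists N : nat, (0 < N)%N /\ forall x : G, x *+ N = 0.
Proof.
move=> [s gen_s] wmG; have [N [l [N0 ind_l sN]]] := independent_subfamily s.
have GN := generators_in_span gen_s sN.
case: l ind_l {sN} GN => [_ GN | x l ind_xl GN].
  by case: N N0 GN => // N N0 GN; exists N.
have N1_inj (g : G) : g *~ (N + 1) = 0 -> g = 0.
  move=> gN1; have : g *~ N = 0.
    apply: (in_span_torsion_free ind_xl (GN g) (a := N + 1)).
      by rewrite gt_eqF // ltr_wpDl // ltW.
    by rewrite mulrzAC gN1 mul0rz.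
  by move=> gN; rewrite mulrzDr gN add0r in gN1.
have [h xE] : exists h : G, x = h *~ (N + 1).
  have [f f_bij] := wmG (N + 1).
  have f0 a : f a = 0.
    by apply: val_inj; apply: N1_inj; have /asboolP := valP (f a).
  have : x - 0 \in multiples_of G (N + 1).
    by rewrite Quotient.idealrBE; apply/eqP/(bij_inj f_bij); rewrite !f0.
  by rewrite subr0 => /asboolP.
have [m lm] := GN h; case: ind_xl => _ x_ind.
have : N - m * (N + 1) = 0.
  apply: x_ind; have := in_span_mulrz (N + 1) lm.
  by rewrite mulrzBl mulrzAC -xE mulrzBr mulrzA.
move/eqP; rewrite subr_eq0 => /eqP Nm; have N1 : 0 <= N + 1 by rewrite addr_ge0 ?ltW.
have [m_le0 | m_gt0] := lerP m 0.
  by have := mulr_le0_ge0 m_le0 N1; rewrite -Nm leNgt N0.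
have := ler_peMl N1 (_ : 1 <= m); rewrite -gtz0_ge1 m_gt0 -Nm => /(_ isT).
by rewrite gerDl ler10.
Qed.

Lemma finite_of_bounded (G : zmodType) N :
  finitely_generated G -> (0 < N)%N -> (forall x : G, x *+ N = 0) ->
  exists s : seq G, forall x, x \in s.
Proof.
move=> [s gen_s] N0 killG; have N0' : (N : int) != 0 by case: N N0 {killG}.
exists [seq \sum_(i < size s) s`_i *+ c i | c : {ffun 'I_(size s) -> 'I_N.-1.+1}].
move=> g; have [c ->] := gen_s g.
apply/imageP; exists [ffun i => inord `|(c i %% N)%Z|%N] => //.
apply: eq_bigr => i _; rewrite ffunE inordK; last first.
  by rewrite prednK // -ltz_nat gez0_abs ?modz_ge0 // ltz_pmod.
rewrite {1}(divz_eq (c i) N) mulrzDr mulrC mulrzA -pmulrn killG mul0rz add0r.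
by rewrite pmulrn gez0_abs ?modz_ge0.
Qed.

(** * The equivalence *)

Lemma eq_zmodClosed (G : zmodType) (S T : zmodClosed G) : S =i T -> S = T.
Proof.
case: S T => [S [[cS] [cS']]] [T [[cT] [cT']]] /= eqST.
have eST : S = T by apply/funext=> x; apply: eqST.
by subst T; rewrite (Prop_irrelevance cS cT) (Prop_irrelevance cS' cT').
Qed.

Lemma weakly_morphic_of_morphic (G : zmodType) : morphic G -> weakly_morphic G.
Proof.
move=> morG a; pose f : {additive G -> G} := HB.pack_for {additive G -> G}
  (fun x : G => x *~ a)
  (GRing.isZmodMorphism.Build G G _ (fun x y => mulrzBl x y a)).
have <- : image_of f = multiples_of G a :> zmodClosed G.
  apply: eq_zmodClosed => x.
  by apply/asboolP/asboolP=> -[z zx]; exists z; symmetry.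
have <- : kernel_of f = annihilated_by G a :> zmodClosed G.
  by apply: eq_zmodClosed => x; apply/asboolP/asboolP.
exact: morG.
Qed.

Theorem theorem6 (G : zmodType) (Gfg : finitely_generated G) :
  morphic G <->
  (weakly_morphic G /\
   forall (p : nat) (p_prime : prime p), exists n k : nat,
     isomorphic (subgroup_type (primary_component G p_prime))
                (homogeneous_group p k n)).
Proof.
have finG : weakly_morphic G -> exists F : finZmodType, G = F.
  move=> /(bounded_of_weakly_morphic Gfg)[N [N0 killG]].
  by have [s /finite_zmodP] := finite_of_bounded Gfg N0 killG.
split=> [morG | [wmG homG]].
  have wmG := weakly_morphic_of_morphic morG; split=> // p p_pr.
  have [F eqG] := finG wmG; subst G.
  have exP := exact_primary_component p_pr (exponent_gt0 _) (exact_of_morphic morG).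
  have [B eqB] : exists B : finZmodType,
      subgroup_type (primary_component F p_pr) = B :> zmodType.
    exact: finite_zmodP (@mem_subgroup_enum F (primary_component F p_pr)).
  have [n isoB] : exists n, isomorphic (subgroup_type (primary_component F p_pr))
      (homogeneous_group p (logn p (exponent [set: F])) n).
    by move: exP; rewrite eqB; apply: homogeneous_of_exact.
  by exists n, (logn p (exponent [set: F])).
have [F eqG] := finG wmG; subst G.
apply: (morphic_of_exact (exponent_gt0 [group of [set: F]])).
apply: exact_of_primary_components => [|x|M killM|p p_pr].
- exact: exponent_gt0.
- by rewrite -FinRing.zmodXgE expg_exponent ?inE.
- by apply/exponentP=> x _; rewrite FinRing.zmodXgE.
have [n [k isoP]] := homG p p_pr; exists k; apply: exact_isomorphic isoP _.
have := exact_cyclic_power (p ^ k).-1 n.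
by rewrite prednK // expn_gt0 prime_gt0.
Qed.
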